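(* Let $m=5$, $r=3$, and for $Z=(c_1,c_2,c_3)\in\mathfrak z=\mathbb R^3$ let $j_Z$, respectively $j'_Z$, be the endomorphism of $\mathfrak v=\mathbb R^5$ given with respect to the standard basis by the matrix $$\begin{pmatrix}0&0&0&-c_3&c_2\\0&0&c_3&0&-c_1\\0&-c_3&0&0&0\\c_3&0&0&0&0\\-c_2&c_1&0&0&0\end{pmatrix},\quad\text{respectively}\quad\begin{pmatrix}0&-c_3&0&0&0\\c_3&0&0&0&0\\0&0&0&-c_3&c_2\\0&0&c_3&0&-c_1\\0&0&-c_2&c_1&0\end{pmatrix}.$$ Then the two isospectral manifolds $(\Gamma(j)\backslash G(j),g(j))$ and $(\Gamma(j')\backslash G(j'),g(j'))$ differ in each of the values of $( * )$, $( ** )$, $({*}{*}{*})$, and $|\nabla\mathrm{ric}|^2$.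
   Context: Let $\mathfrak v=\mathbb R^m$, $\mathfrak z=\mathbb R^r$ carry the standard inner products. Given a linear map $j:\mathfrak z\to\mathfrak{so}(\mathfrak v)$, $Z\mapsto j_Z$, let $\mathfrak g(j)$ be the two-step nilpotent metric Lie algebra with underlying vector space $\mathfrak v\oplus\mathfrak z$, standard inner product, and bracket $[\,,\,]^j$ defined by: $\mathfrak z$ is central, $[\mathfrak v,\mathfrak v]^j\subseteq\mathfrak z$, and $\langle j_ZX,Y\rangle=\langle Z,[X,Y]^j\rangle$ for $X,Y\in\mathfrak v$, $Z\in\mathfrak z$. Let $G(j)$ be the simply connected Lie group with Lie algebra $\mathfrak g(j)$, endowed with the left invariant Riemannian metric $g(j)$ given by this inner product at the identity, and let $\exp^j:\mathfrak g(j)\to G(j)$ be the Lie group exponential map (a diffeomorphism). Put $\Gamma(j):=\exp^j(\mathbb Z^m\oplus\tfrac12\mathbb Z^r)$, which is a discrete cocompact subgroup if $[\mathbb Z^m,\mathbb Z^m]^j\subseteq\mathbb Z^r$ (as is the case here). The quotient $\Gamma(j)\backslash G(j)$ carries the induced metric, again denoted $g(j)$. Two closed Riemannian manifolds are isospectral if their Laplace operators on functions have the same eigenvalues with multiplicities. The two manifolds in the claim are known to be isospectral. Curvature conventions: $R(X,Y)=\nabla_{[X,Y]}-[\nabla_X,\nabla_Y]$, $R_{ijkl}=\langle R(e_i,e_j)e_k,e_l\rangle$ for an orthonormal basis $\{e_i\}$ of the tangent space, and $\mathrm{ric}_{ij}=\sum_kR_{ikjk}$ is the Ricci tensor. With the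 Einstein summation convention (sum over repeated indices), $( * ):=\mathrm{ric}_{ik}\,\mathrm{ric}_{jl}R_{ijkl}$, $( ** ):=\mathrm{ric}_{ij}R_{ipqr}R_{jpqr}$, $({*}{*}{*}):=\nabla_i\mathrm{ric}_{jk}\nabla_k\mathrm{ric}_{ij}$. By local homogeneity these, and $|\nabla\mathrm{ric}|^2$, are constant functions on each of the manifolds. *)

(* Defs.v *)
From HB Require Import structures.
From mathcomp Require Import all_boot all_order all_algebra archimedean.
From mathcomp Require Import ring lra.
From mathcomp Require Import all_classical all_reals all_analysis.
Set Implicit Arguments.
Unset Strict Implicit.
Unset Printing Implicit Defensive.
Import Order.TTheory GRing.Theory Num.Theory.
Import numFieldNormedType.Exports.
Local Open Scope classical_set_scope.
Local Open Scope ring_scope.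

Definition dotv (R : realType) n (u v : 'rV[R]_n) : R := (u *m v^T) 0 0.

Definition evec (R : realType) n (i : 'I_n) : 'rV[R]_n := delta_mx 0 i.
Arguments evec {R n} i.

Definition partial (R : realType) n (i : 'I_n) (f : 'rV[R]_n -> R) :
  'rV[R]_n -> R := 'D_(evec i) f.

Definition vderive (R : realType) n k (v : 'rV[R]_n) (f : 'rV[R]_n -> 'rV[R]_k)
  (x : 'rV[R]_n) : 'rV[R]_k := 'D_v f x.

Definition smooth_on (R : realType) n (U : set 'rV[R]_n) (f : 'rV[R]_n -> R) :=
  forall (s : seq 'I_n) x, U x -> differentiable (foldr (@partial R n) f s) x.

(* A metric in a coordinate domain is a matrix-valued function g, with
   g_x(u, v) = inner (g x) u v; vector fields are functions 'rV_n -> 'rV_n. *)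
Definition inner (R : realType) n (g : 'M[R]_n) (u v : 'rV[R]_n) : R :=
  (u *m g *m v^T) 0 0.

Section LocalGeometry.
Context {R : realType} {n : nat} (g : 'rV[R]_n -> 'M[R]_n).
Local Notation V := 'rV[R]_n.
Implicit Types (X Y Z : V -> V) (x u v w z : V).

Definition christoffel (l i j : 'I_n) x : R :=
  2^-1 * \sum_s invmx (g x) l s *
    (partial i (fun y => g y s j) x + partial j (fun y => g y s i) x
     - partial s (fun y => g y i j) x).

Definition nabla X Y : V -> V := fun x =>
  vderive (X x) Y x + \row_l \sum_i \sum_j X x 0 i * Y x 0 j * christoffel l i j x.

Definition lie X Y : V -> V := fun x => vderive (X x) Y x - vderive (Y x) X x.

Definition curv X Y Z : V -> V := fun x =>
  nabla (lie X Y) Z x - (nabla X (nabla Y Z) x - nabla Y (nabla X Z) x).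

Definition curv_coord (a b c d : 'I_n) x : R :=
  inner (g x)
    (curv (cst (evec a)) (cst (evec b)) (cst (evec c)) x) (evec d).

Definition ric_coord (a b : 'I_n) x : R :=
  \sum_c \sum_d invmx (g x) c d * curv_coord a c b d x.

(* the index c of the derivative comes first *)
Definition nabla_ric_coord (c a b : 'I_n) x : R :=
  partial c (ric_coord a b) x
  - \sum_s christoffel s c a x * ric_coord s b x
  - \sum_s christoffel s c b x * ric_coord a s x.

Definition curv_tensor x u v w z : R :=
  \sum_a \sum_b \sum_c \sum_d
    u 0 a * v 0 b * w 0 c * z 0 d * curv_coord a b c d x.

Definition ric_tensor x u v : R :=
  \sum_a \sum_b u 0 a * v 0 b * ric_coord a b x.

Definition nabla_ric_tensor x w u v : R :=
  \sum_c \sum_a \sum_b w 0 c * u 0 a * v 0 b * nabla_ric_coord c a b x.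

(* The rows of E are the vectors of a basis of the tangent space. *)
Definition orthonormal x (E : 'M[R]_n) := E *m g x *m E^T = 1%:M.

Section Frame.
Context (x : V) (E : 'M[R]_n).

Definition Rm (i j k l : 'I_n) : R :=
  curv_tensor x (row i E) (row j E) (row k E) (row l E).

Definition ric (i j : 'I_n) : R := \sum_k Rm i k j k.

Definition nabla_ric (i j k : 'I_n) : R :=
  nabla_ric_tensor x (row i E) (row j E) (row k E).

Definition ric_ric_R : R :=
  \sum_i \sum_j \sum_k \sum_l ric i k * ric j l * Rm i j k l.

Definition ric_R_R : R :=
  \sum_i \sum_j \sum_p \sum_q \sum_r ric i j * Rm i p q r * Rm j p q r.

Definition nabla_ric_nabla_ric : R :=
  \sum_i \sum_j \sum_k nabla_ric i j k * nabla_ric k i j.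

Definition norm2_nabla_ric : R :=
  \sum_i \sum_j \sum_k nabla_ric i j k ^+ 2.

(* [ric_tensor], which is differentiated above, is contracted with the inverse
   metric; it has the components [ric] in orthonormal bases. *)
Lemma ricE i j : orthonormal x E -> ric i j = ric_tensor x (row i E) (row j E).
Proof.
move=> EgE.
have gE : invmx (g x) = E^T *m E.
  have Eu : E \in unitmx by case/mulmx1_unit: EgE => + _; rewrite unitmx_mul => /andP[].
  have EtE : E^T *m E *m g x = 1%:M.
    apply: mulmx1C; rewrite mulmxA; apply: mulmx1C.
    by rewrite mulmxA.
  have gu : g x \in unitmx by case/mulmx1_unit: EtE.
  by rewrite -[RHS]mulmx1 -(mulmxV gu) mulmxA EtE mul1mx.
rewrite /ric /Rm /curv_tensor /ric_tensor exchange_big; apply: eq_bigr => a _ /=.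
under eq_bigr do rewrite exchange_big.
rewrite exchange_big /=; apply: eq_bigr => b _ /=.
rewrite /ric_coord gE exchange_big mulr_sumr; apply: eq_bigr => c _ /=.
rewrite exchange_big mulr_sumr; apply: eq_bigr => d _ /=.
rewrite !mxE mulr_suml mulr_sumr; apply: eq_bigr => k _.
by rewrite !mxE; ring.
Qed.

End Frame.
End LocalGeometry.

Record riemannian_manifold (R : realType) (n : nat) := RiemannianManifold {
  mfd_point :> Type ;
  chart : Type ;
  chart_dom : chart -> set 'rV[R]_n ;
  (* the inverse of the coordinate map, meaningful on [chart_dom a] only *)
  param : chart -> 'rV[R]_n -> mfd_point ;
  metric : chart -> 'rV[R]_n -> 'M[R]_n ;
  dom_open : forall a, open (chart_dom a) ;
  param_inj : forall a x y, chart_dom a x -> chart_dom a y ->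
    param a x = param a y -> x = y ;
  param_cover : forall p, exists a x, chart_dom a x /\ param a x = p ;
  hausdorff : forall p q, p <> q -> exists a b x y,
    [/\ chart_dom a x, param a x = p, chart_dom b y, param b y = q &
     exists A B, [/\ nbhs x A, nbhs y B &
       forall z w, A z -> B w -> param a z <> param b w]] ;
  metric_sym : forall a x, chart_dom a x -> (metric a x)^T = metric a x ;
  metric_gt0 : forall a x v, chart_dom a x -> v != 0 -> 0 < inner (metric a x) v v ;
  metric_smooth : forall a i j, smooth_on (chart_dom a) (fun x => metric a x i j) ;
  transition : forall a b x y, chart_dom a x -> chart_dom b y -> param a x = param b y ->
    exists (U : set 'rV[R]_n) (f : 'rV[R]_n -> 'rV[R]_n),
    [/\ open U /\ U x, U `<=` chart_dom a,
        forall i, smooth_on U (fun z => f z 0 i) &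
        forall z, U z -> [/\ chart_dom b (f z), param b (f z) = param a z &
          forall u v, inner (metric a z) u v =
            inner (metric b (f z)) (vderive u f z) (vderive v f z)]] }.

(* F g x E is a scalar computed from the metric g at x in the g_x-orthonormal
   basis E; its value at p must not depend on the chart nor on the basis. *)
Definition scalar_at (R : realType) n (M : riemannian_manifold R n)
    (F : ('rV[R]_n -> 'M[R]_n) -> 'rV[R]_n -> 'M[R]_n -> R) (p : M) (c : R) :=
  forall (a : chart M) x E, chart_dom a x -> param a x = p ->
    orthonormal (metric a) x E -> F (metric a) x E = c.

Definition differ_in (R : realType) n (M M' : riemannian_manifold R n)
    (F : ('rV[R]_n -> 'M[R]_n) -> 'rV[R]_n -> 'M[R]_n -> R) :=
  exists c c' : R, [/\ forall p : M, scalar_at F p c,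
    forall p : M', scalar_at F p c' & c <> c'].

(* Vectors are rows, so that j_Z X is X *m (j Z)^T. *)
Record so_map (R : realType) (m r : nat) := SoMap {
  so_fun :> 'rV[R]_r -> 'M[R]_m ;
  so_linear : linear so_fun ;
  so_skew : forall Z, (so_fun Z)^T = - so_fun Z }.

Definition intvec (R : realType) n (v : 'rV[R]_n) :=
  forall i, v 0 i \is a Num.int.

Section PolyFun.
Context {R : realType} {T : normedModType R} {I : Type} (c : I -> T -> R).

Inductive polyfun : (T -> R) -> Prop :=
| PolyCst a : polyfun (fun=> a)
| PolyCoord i : polyfun (c i)
| PolyD f h : polyfun f -> polyfun h -> polyfun (fun x => f x + h x)
| PolyM f h : polyfun f -> polyfun h -> polyfun (fun x => f x * h x).

Lemma polyfun_sum (J : finType) (F : J -> T -> R) :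
  (forall k, polyfun (F k)) -> polyfun (fun x => \sum_k F k x).
Proof.
move=> pF; rewrite (_ : (fun x => _) = \sum_k F k); last first.
  by apply/funext => x; rewrite fct_sumE.
by elim/big_ind : _ => // [|f h]; [exact: (PolyCst 0)|exact: PolyD].
Qed.

Lemma polyfun_differentiable f x : (forall i, differentiable (c i) x) ->
  polyfun f -> differentiable f x.
Proof.
move=> dc; elim=> [a|i|{}f h _ df _ dh|{}f h _ df _ dh] //.
- exact: differentiableD.
- exact: differentiableM.
Qed.

Lemma polyfun_continuous f : (forall i, continuous (c i)) ->
  polyfun f -> continuous f.
Proof.
move=> cc; elim=> [a|i|{}f h _ cf _ ch|{}f h _ cf _ ch] //.
- by move=> x; exact: cvg_cst.
- by move=> x; apply: cvgD; [exact: cf|exact: ch].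
- by move=> x; apply: cvgM; [exact: cf|exact: ch].
Qed.

Lemma polyfun_derive v f : (forall i x, differentiable (c i) x) ->
  (forall i, polyfun ('D_v (c i))) -> polyfun f -> polyfun ('D_v f).
Proof.
move=> dc pc pf; elim: pf => [a|i|{}f h pf df ph dh|{}f h pf df ph dh].
- rewrite (_ : 'D_v _ = fun=> 0); first exact: PolyCst.
  by apply/funext => x; rewrite derive_cst.
- exact: pc.
- rewrite (_ : 'D_v _ = fun x => 'D_v f x + 'D_v h x); first exact: PolyD.
  by apply/funext => x; rewrite deriveD//; apply: diff_derivable;
    apply: polyfun_differentiable.
- rewrite (_ : 'D_v _ = fun x => f x * 'D_v h x + h x * 'D_v f x).
    by apply: PolyD; apply: PolyM.
  by apply/funext => x; rewrite deriveM//; apply: diff_derivable;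
    apply: polyfun_differentiable.
Qed.

End PolyFun.

Section Affine.
Context {R : realType} {n : nat}.

Definition xcoord (i : 'I_n) (x : 'rV[R]_n) : R := x 0 i.

Lemma derive_affine k (f A : 'rV[R]_n -> 'rV[R]_k) x u :
  (forall h, f (h *: u + x) = f x + h *: A u) -> vderive u f x = A u.
Proof.
move=> fA; apply: cvg_lim => //; apply: cvg_near_cst.
near=> h; rewrite /= fA addrAC subrr add0r scalerA mulVf ?scale1r//.
by near: h; exact: nbhs_dnbhs_neq.
Unshelve. all: by end_near. Qed.

Lemma polyfun_smooth (U : set 'rV[R]_n) f : polyfun xcoord f -> smooth_on U f.
Proof.
move=> pf s x _.
have dc i (y : 'rV[R]_n) : differentiable (xcoord i) y.
  exact: differentiable_coord.
apply: (polyfun_differentiable (c := xcoord)) => //.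
elim: s => //= i s; apply: polyfun_derive => // k.
rewrite (_ : 'D_(evec i) _ = fun=> evec i 0 k); first exact: PolyCst.
apply/funext => y; apply: cvg_lim => //; apply: cvg_near_cst.
near=> h; rewrite /xcoord/= !mxE addrK scalerA mulVf ?scale1r//.
by near: h; exact: nbhs_dnbhs_neq.
Unshelve. all: by end_near. Qed.

End Affine.

Section NilpotentGroup.
Context {R : realType} {m r : nat} (j : so_map R m r).
Local Notation V := 'rV[R]_(m + r).
Implicit Types (x y z u v : V) (X Y : 'rV[R]_m) (Z : 'rV[R]_r).

(* The bracket [v, v] -> z, componentwise <j_{e_k} X, Y> = [X, Y]_k. *)
Definition brv X Y : 'rV[R]_r := \row_k dotv (X *m (j (evec k))^T) Y.

Definition br x y : V := row_mx 0 (brv (lsubmx x) (lsubmx y)).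

(* The simply connected group in exponential coordinates, in which exp^j is
   the identity; the product is the Campbell-Hausdorff formula. *)
Definition nil_mul x y : V := x + y + 2^-1 *: br x y.

(* The left invariant metric: the inner product of the images of two vectors
   under the differential at x of the left translation by x^-1 = - x. *)
Definition nil_metric x : 'M[R]_(m + r) := \matrix_(a, b)
  dotv (vderive (evec a) (nil_mul (- x)) x) (vderive (evec b) (nil_mul (- x)) x).

Definition Gamma : set V := [set row_mx X Z | X in @intvec R m &
  Z in [set Z | intvec (2 *: Z)]].

Definition nil_orbit x : set V := [set nil_mul g x | g in Gamma].

Definition left_field u : V -> V := fun x => vderive u (nil_mul x) 0.

Lemma brvE X Y k :
  brv X Y 0 k = \sum_a \sum_b X 0 a * j (evec k) b a * Y 0 b.
Proof.
rewrite mxE /dotv mxE exchange_big; apply: eq_bigr => b _ /=.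
by rewrite !mxE mulr_suml; apply: eq_bigr => a _; rewrite !mxE.
Qed.

Lemma brvP X Y Z : dotv (X *m (j Z)^T) Y = dotv Z (brv X Y).
Proof.
pose L := @GRing.isLinear.Build R _ _ _ _ (so_linear j).
pose jl : {linear 'rV[R]_r -> 'M[R]_m} := HB.pack (so_fun j) L.
have -> : j Z = \sum_k Z 0 k *: j (evec k).
  rewrite -[LHS]/(jl Z) [in LHS](row_sum_delta Z) linear_sum.
  by apply: eq_bigr => k _; rewrite linearZ.
rewrite /dotv linear_sum mulmx_sumr mulmx_suml summxE [RHS]mxE.
apply: eq_bigr => k _.
by rewrite linearZ -scalemxAr -scalemxAl mxE [in RHS]mxE [in RHS]mxE.
Qed.

Lemma brv_linearr X : linear (brv X).
Proof.
move=> a Y Y'; apply/rowP => k.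
have -> (u v : 'rV[R]_r) : (a *: u + v) 0 k = a * u 0 k + v 0 k by rewrite !mxE.
rewrite !brvE mulr_sumr.
rewrite -big_split; apply: eq_bigr => i _ /=; rewrite mulr_sumr -big_split.
by apply: eq_bigr => l _ /=; rewrite !mxE; ring.
Qed.

Lemma brv_anti X Y : brv X Y = - brv Y X.
Proof.
apply/rowP => k; rewrite [RHS]mxE !brvE exchange_big -sumrN.
apply: eq_bigr => a _; rewrite -sumrN; apply: eq_bigr => b _.
have /matrixP/(_ b a) := so_skew j (evec k); rewrite !mxE => ->.
by ring.
Qed.

Lemma brDr x y z : br x (y + z) = br x y + br x z.
Proof.
rewrite /br add_row_mx addr0; congr row_mx.
by have := brv_linearr (lsubmx x) 1 (lsubmx y) (lsubmx z); rewrite !scale1r linearD.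
Qed.

Lemma br_anti x y : br x y = - br y x.
Proof. by rewrite /br opp_row_mx oppr0 -brv_anti. Qed.

Lemma br0r x : br x 0 = 0.
Proof. by have := brDr x 0 0; rewrite addr0 => /esym/eqP; rewrite -subr_eq0 addrK => /eqP. Qed.

Lemma brZr a x y : br x (a *: y) = a *: br x y.
Proof.
rewrite /br scale_row_mx scaler0; congr row_mx.
have b0 : brv (lsubmx x) 0 = 0.
  by have := f_equal rsubmx (br0r x); rewrite /br row_mxKr !linear0.
by have := brv_linearr (lsubmx x) a (lsubmx y) 0; rewrite !addr0 b0 addr0 -linearZ.
Qed.

Lemma brNr x y : br x (- y) = - br x y.
Proof. by rewrite -scaleN1r brZr scaleN1r. Qed.

Lemma brDl x y z : br (x + y) z = br x z + br y z.
Proof. by rewrite br_anti brDr opprD -!br_anti. Qed.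

Lemma brZl a x y : br (a *: x) y = a *: br x y.
Proof. by rewrite br_anti brZr -scalerN -br_anti. Qed.

Lemma brNl x y : br (- x) y = - br x y.
Proof. by rewrite br_anti brNr -br_anti. Qed.

Lemma br0l x : br 0 x = 0.
Proof. by rewrite br_anti br0r oppr0. Qed.

Lemma brxx x : br x x = 0.
Proof.
have /eqP := br_anti x x; rewrite -subr_eq0 opprK -mulr2n -scaler_nat.
by rewrite scaler_eq0 pnatr_eq0 => /eqP.
Qed.

Lemma br_brr x y z : br x (br y z) = 0.
Proof.
by rewrite -[RHS](br0r x) {2}/br {1}/br row_mxKl {1}/br linear0.
Qed.

Lemma br_brl x y z : br (br x y) z = 0.
Proof. by rewrite br_anti br_brr oppr0. Qed.

Definition brE := (brDl, brDr, brZl, brZr, brNl, brNr, br_brl, br_brr).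

Lemma nil_mulA x y z : nil_mul x (nil_mul y z) = nil_mul (nil_mul x y) z.
Proof.
rewrite /nil_mul !brE !scaler0 !addr0 !scalerDr.
by apply/rowP => i; rewrite !mxE; ring.
Qed.

Lemma nil_mul0x x : nil_mul 0 x = x.
Proof. by rewrite /nil_mul br0l scaler0 addr0 add0r. Qed.

Lemma nil_mulx0 x : nil_mul x 0 = x.
Proof. by rewrite /nil_mul br0r scaler0 !addr0. Qed.

Lemma nil_mulNx x : nil_mul (- x) x = 0.
Proof. by rewrite /nil_mul brNl brxx oppr0 scaler0 addNr addr0. Qed.

Lemma nil_mulxN x : nil_mul x (- x) = 0.
Proof. by rewrite /nil_mul brNr brxx oppr0 scaler0 subrr addr0. Qed.

Lemma one_parameter_subgroup x (s t : R) :
  nil_mul (s *: x) (t *: x) = (s + t) *: x.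
Proof. by rewrite /nil_mul brZl brZr brxx !scaler0 addr0 scalerDl. Qed.

Lemma derive_mul p x u : vderive u (nil_mul p) x = u + 2^-1 *: br p u.
Proof.
apply: (derive_affine (A := fun u => u + 2^-1 *: br p u)) => h.
by rewrite /nil_mul !brE; apply/rowP => i; rewrite !mxE; ring.
Qed.

Lemma left_fieldE u x : left_field u x = u + 2^-1 *: br x u.
Proof. exact: derive_mul. Qed.

Lemma lie_left_field u v :
  lie (left_field u) (left_field v) = left_field (br u v).
Proof.
have dl w x y : vderive x (left_field w) y = 2^-1 *: br x w.
  apply: (derive_affine (A := fun x => 2^-1 *: br x w)) => h.
  by rewrite !left_fieldE !brE; apply/rowP => i; rewrite !mxE; ring.
apply/funext => x; transitivity
    (2^-1 *: br (left_field u x) v - 2^-1 *: br (left_field v x) u).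
  by congr (_ - _); exact: dl.
rewrite !left_fieldE !brE (br_anti v u).
move: (br u v) => w; rewrite !scaler0 !addr0 scalerN opprK -scalerDl.
by rewrite (_ : _ + _ = 1) ?scale1r//; field.
Qed.

Lemma dotvC n (u v : 'rV[R]_n) : dotv u v = dotv v u.
Proof. by rewrite /dotv !mxE; apply: eq_bigr => i _; rewrite !mxE mulrC. Qed.

Lemma dotv_row k n (A B : 'M[R]_(n, k)) a b :
  dotv (row a A) (row b B) = (A *m B^T) a b.
Proof. by rewrite /dotv !mxE; apply: eq_bigr => i _; rewrite !mxE. Qed.

Lemma inner_row n (g A : 'M[R]_n) a b :
  inner g (row a A) (row b A) = (A *m g *m A^T) a b.
Proof. by rewrite -dotv_row /dotv row_mul. Qed.

Lemma nil_metricE x a b : nil_metric x a b =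
  dotv (evec a - 2^-1 *: br x (evec a)) (evec b - 2^-1 *: br x (evec b)).
Proof. by rewrite mxE !derive_mul !brNl !scalerN. Qed.

Lemma inner_metricE x u v : inner (nil_metric x) u v =
  dotv (u - 2^-1 *: br x u) (v - 2^-1 *: br x v).
Proof.
pose f w : V := w - 2^-1 *: br x w.
have fl : linear f.
  by move=> a y z; rewrite /f !brE; apply/rowP => i; rewrite !mxE; ring.
pose L := @GRing.isLinear.Build R V V _ _ fl.
pose fL : {linear V -> V} := HB.pack f L.
have -> : nil_metric x = lin1_mx fL *m (lin1_mx fL)^T.
  by apply/matrixP => a b; rewrite nil_metricE -dotv_row !rowE !mul_rV_lin1.
rewrite /inner mulmxA -mulmxA -trmx_mul.
by rewrite (mul_rV_lin1 fL u) (mul_rV_lin1 fL v).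
Qed.

Lemma left_field_orthonormal x :
  orthonormal nil_metric x (\matrix_a left_field (evec a) x).
Proof.
apply/matrixP => a b; rewrite -inner_row !rowK inner_metricE !left_fieldE !brE.
rewrite !scaler0 !addr0 !addrK /dotv trmx_delta mul_delta_mx_cond [RHS]mxE.
by case: eqP => _; rewrite ?mulr1n ?mulr0n mxE.
Qed.

Lemma inner_translate p x u v : inner (nil_metric x) u v =
  inner (nil_metric (nil_mul p x)) (vderive u (nil_mul p) x) (vderive v (nil_mul p) x).
Proof.
have E w : w + 2^-1 *: br p w - 2^-1 *: br (nil_mul p x) (w + 2^-1 *: br p w) =
    w - 2^-1 *: br x w.
  have -> : br (nil_mul p x) (w + 2^-1 *: br p w) = br p w + br x w.
    by rewrite /nil_mul !brE !scaler0 !addr0.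
  by rewrite scalerDr opprD addrA addrK.
rewrite (derive_mul p x u) (derive_mul p x v).
transitivity (dotv (u - 2^-1 *: br x u) (v - 2^-1 *: br x v)).
  exact: inner_metricE.
by rewrite -(E u) -(E v); symmetry; apply: inner_metricE.
Qed.

Lemma dotv_gt0 n (w : 'rV[R]_n) : w != 0 -> 0 < dotv w w.
Proof.
move=> /rV0Pn[i wi]; rewrite /dotv mxE (bigD1 i)//= mxE ltr_pwDl//.
  by rewrite -expr2 lt_neqAle sqr_ge0 eq_sym sqrf_eq0 wi.
by apply: sumr_ge0 => k _; rewrite mxE -expr2 sqr_ge0.
Qed.

Lemma nil_metric_gt0 x v : v != 0 -> 0 < inner (nil_metric x) v v.
Proof.
move=> v0; rewrite inner_metricE; apply: dotv_gt0; apply: contra_neq v0 => E.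
have : left_field (v - 2^-1 *: br x v) x = 0 by rewrite E left_fieldE br0r scaler0 addr0.
by rewrite left_fieldE !brE scaler0 oppr0 addr0 subrK.
Qed.

Lemma nil_metric_sym x : (nil_metric x)^T = nil_metric x.
Proof.
apply/matrixP => a b; rewrite mxE; etransitivity; first exact: nil_metricE.
symmetry; etransitivity; first exact: nil_metricE.
exact: dotvC.
Qed.

Section PolyBr.
Context {T : normedModType R} {I : Type} (c : I -> T -> R).

Lemma polyfun_br (f h : T -> V) i :
  (forall k, polyfun c (fun t => f t 0 k)) ->
  (forall k, polyfun c (fun t => h t 0 k)) ->
  polyfun c (fun t => br (f t) (h t) 0 i).
Proof.
move=> pf ph; case: (split_ordP i) => k ->{i}.
  rewrite (_ : (fun t => _) = fun=> 0); first exact: PolyCst.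
  by apply/funext => t; rewrite row_mxEl mxE.
rewrite (_ : (fun t => _) = fun t => \sum_a \sum_b
    f t 0 (lshift r a) * j (evec k) b a * h t 0 (lshift r b)).
  apply: polyfun_sum => a; apply: polyfun_sum => b.
  by do 2 ?apply: PolyM => //; apply: PolyCst.
apply/funext => t; rewrite row_mxEr brvE; apply: eq_bigr => a _.
by apply: eq_bigr => b _; rewrite !mxE.
Qed.

Lemma polyfun_lin (f h : T -> V) (a : R) i :
  (forall k, polyfun c (fun t => f t 0 k)) ->
  (forall k, polyfun c (fun t => h t 0 k)) ->
  polyfun c (fun t => (f t + a *: h t) 0 i).
Proof.
move=> pf ph; rewrite (_ : (fun t => _) = fun t => f t 0 i + a * h t 0 i).
  by apply: PolyD => //; apply: PolyM => //; apply: PolyCst.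
by apply/funext => t; rewrite !mxE.
Qed.

Lemma polyfun_mul (f h : T -> V) i :
  (forall k, polyfun c (fun t => f t 0 k)) ->
  (forall k, polyfun c (fun t => h t 0 k)) ->
  polyfun c (fun t => nil_mul (f t) (h t) 0 i).
Proof.
move=> pf ph; apply: polyfun_lin => k; last exact: polyfun_br.
by have := polyfun_lin 1 k pf ph; under eq_fun do rewrite scale1r.
Qed.

End PolyBr.

Lemma mul_smooth U p i : smooth_on U (fun z => nil_mul p z 0 i).
Proof.
apply: polyfun_smooth; apply: polyfun_mul => k; [exact: PolyCst|].
exact: (PolyCoord (@xcoord R (m + r))).
Qed.

Lemma nil_metric_smooth U a b : smooth_on U (fun x => nil_metric x a b).
Proof.
apply: polyfun_smooth.
have pE e k : polyfun xcoord (fun x => (e - 2^-1 *: br x e) 0 k).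
  have := @polyfun_lin _ _ xcoord (fun=> e) (fun x => br x e) (- 2^-1) k.
  under [X in _ -> _ -> polyfun _ X]eq_fun do rewrite scaleNr.
  apply=> i; first exact: PolyCst.
  apply: polyfun_br => l; last exact: PolyCst.
  exact: (PolyCoord (@xcoord R (m + r))).
under eq_fun do rewrite nil_metricE /dotv mxE.
apply: polyfun_sum => k; apply: PolyM => //.
by under eq_fun do rewrite mxE.
Qed.

Section Lattice.
Context (j_int : forall X Y, intvec X -> intvec Y -> intvec (brv X Y)).

Lemma GammaE x : Gamma x <->
  intvec (lsubmx x) /\ intvec (2 *: rsubmx x).
Proof.
split=> [[X Xi [Z Zi <-]]|[Xi Zi]]; first by rewrite row_mxKl row_mxKr.
by exists (lsubmx x) => //; exists (rsubmx x) => //; rewrite hsubmxK.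
Qed.

Lemma Gamma0 : Gamma 0.
Proof. by apply/GammaE; split=> i; rewrite !mxE ?mulr0 rpred0. Qed.

Lemma GammaN x : Gamma x -> Gamma (- x).
Proof.
move=> /GammaE[Xi Zi]; apply/GammaE; split=> i.
  by have := Xi i; rewrite !mxE rpredN.
by have := Zi i; rewrite !mxE mulrN rpredN.
Qed.

Lemma GammaM x y : Gamma x -> Gamma y -> Gamma (nil_mul x y).
Proof.
move=> /GammaE[Xi Zi] /GammaE[Yi Wi]; apply/GammaE; split=> i.
  rewrite /nil_mul /br !linearD linearZ/= row_mxKl scaler0 addr0 mxE.
  by rewrite rpredD.
have -> : rsubmx (nil_mul x y) =
    rsubmx x + rsubmx y + 2^-1 *: brv (lsubmx x) (lsubmx y).
  by rewrite /nil_mul /br !linearD linearZ/= row_mxKr.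
rewrite !scalerDr scalerA divff ?pnatr_eq0// scale1r mxE [X in X + _]mxE.
by rewrite !rpredD//; exact: j_int.
Qed.

Lemma orbit_eq x y : (nil_orbit x = nil_orbit y) <-> Gamma (nil_mul y (- x)).
Proof.
split=> [E|G].
  have : nil_orbit y y by exists 0; [exact: Gamma0|rewrite nil_mul0x].
  by rewrite -E => -[g Gg <-]; rewrite -nil_mulA nil_mulxN nil_mulx0.
pose q := nil_mul y (- x); have Gq : Gamma q by [].
have yE : nil_mul q x = y by rewrite -nil_mulA nil_mulNx nil_mulx0.
have xE : nil_mul (- q) y = x by rewrite -yE nil_mulA nil_mulNx nil_mul0x.
apply/seteqP; split=> z [g Gg <-].
  by exists (nil_mul g (- q)); [exact/GammaM/GammaN|rewrite -nil_mulA xE].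
by exists (nil_mul g q); [exact: GammaM|rewrite -nil_mulA yE].
Qed.

Lemma near_int (a : R) : \forall t \near a, t \is a Num.int -> t = a.
Proof.
have [ai|ai] := boolP (a \is a Num.int).
  near=> t => ti; apply/eqP; rewrite -subr_eq0; apply: contraTT isT => ta.
  have : 1 <= `|t - a| by apply: norm_intr_ge1 => //; rewrite rpredB.
  rewrite leNgt distrC; suff -> : `|a - t| < 1 by [].
  by near: t; apply/nbhs_ballP; exists 1 => //=.
have /andP[fa af] := floor_itv a.
have {}fa : (Num.floor a)%:~R < a.
  by rewrite lt_neqAle fa andbT; apply/eqP => E; rewrite -E intr_int in ai.
near=> t => /intrP[k tk].
have : (Num.floor a)%:~R < t by near: t; exact: lt_nbhsr.
have : t < (Num.floor a + 1)%:~R by near: t; exact: lt_nbhsl.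
by rewrite tk !ltr_int ltzD1 => /le_lt_trans h/h; rewrite ltxx.
Unshelve. all: by end_near. Qed.

(* Gamma is discrete and closed. *)
Lemma Gamma_near x y : \forall p \near (x, y),
  Gamma (nil_mul p.2 (- p.1)) -> nil_mul p.2 (- p.1) = nil_mul y (- x).
Proof.
pose c (k : 'I_(m + r) + 'I_(m + r)) (p : V * V) : R :=
  match k with inl k => p.1 0 k | inr k => p.2 0 k end.
have cc k : continuous (c k).
  case: k => k p; apply: (@continuous_comp _ _ _ _ (fun z : V => z 0 k)).
  - exact: cvg_fst.
  - exact: coord_continuous.
  - exact: cvg_snd.
  - exact: coord_continuous.
pose q (p : V * V) := nil_mul p.2 (- p.1).
have qc i : continuous (fun p => q p 0 i).
  apply: (polyfun_continuous (c := c)) => //.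
  apply: polyfun_mul => k; first exact: (PolyCoord c (inr k)).
  rewrite (_ : (fun _ => _) = fun p => -1 * c (inl k) p).
    by apply: PolyM; [exact: PolyCst|exact: (PolyCoord c (inl k))].
  by apply/funext => t; rewrite mxE mulN1r.
have q2c i : continuous (fun p => 2 * q p 0 i).
  by move=> p; apply: cvgM; [exact: cvg_cst|exact: qc].
have near1 : \forall p \near (x, y), forall i,
    q p 0 i \is a Num.int -> q p 0 i = q (x, y) 0 i.
  apply: (@filter_forall _ _ (fun i p =>
    q p 0 i \is a Num.int -> q p 0 i = q (x, y) 0 i) (nbhs (x, y))) => i.
  exact: (qc i (x, y) _ (near_int _)).
have near2 : \forall p \near (x, y), forall i,
    2 * q p 0 i \is a Num.int -> 2 * q p 0 i = 2 * q (x, y) 0 i.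
  apply: (@filter_forall _ _ (fun i p =>
    2 * q p 0 i \is a Num.int -> 2 * q p 0 i = 2 * q (x, y) 0 i)
    (nbhs (x, y))) => i.
  exact: (q2c i (x, y) _ (near_int _)).
apply: filterS2 near1 near2 => p n1 n2 /GammaE[Xi Zi].
apply/rowP => i; case: (split_ordP i) => k ->.
  by have := Xi k; rewrite mxE; exact: n1.
have := Zi k; rewrite mxE [X in _ * X]mxE => /n2 E.
by apply: (@mulfI _ 2) => //; rewrite pnatr_eq0.
Qed.

(* Gamma \ G, as the set of orbits *)
Definition nilmfd : Type := {p : set V | exists x, p = nil_orbit x}.

Definition nil_proj x : nilmfd := exist _ (nil_orbit x) (ex_intro _ x erefl).

Lemma nil_proj_eq x y : nil_proj x = nil_proj y <-> Gamma (nil_mul y (- x)).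
Proof.
rewrite -orbit_eq; split=> [/(f_equal sval)//|E].
by apply: eq_exist; exact: E.
Qed.

(* Coordinate domains of Gamma \ G are the open sets on which the projection
   G -> Gamma \ G is injective. *)
Record nil_chart := NilChart {
  nil_dom : set V ;
  nil_dom_open : open nil_dom ;
  nil_dom_inj : forall x y, nil_dom x -> nil_dom y ->
    nil_proj x = nil_proj y -> x = y }.

Lemma nil_chart_exists x : exists a : nil_chart, nil_dom a x.
Proof.
have [[A B] [/= Ax Bx] AB] := Gamma_near x x.
pose U := (A `&` B)°.
have Uinj y z : U y -> U z -> nil_proj y = nil_proj z -> y = z.
  move=> /interior_subset[Ay _] /interior_subset[_ Bz] /nil_proj_eq G.
  have /= E := AB (y, z) (conj Ay Bz) G.
  by rewrite -(nil_mul0x y) -(nil_mulxN x) -E -nil_mulA nil_mulNx nil_mulx0.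
exists (NilChart (@open_interior _ (A `&` B)) Uinj).
exact: (filterI Ax Bx).
Qed.

Lemma nil_cover (p : nilmfd) : exists (a : nil_chart) x,
  nil_dom a x /\ nil_proj x = p.
Proof.
case: p => p [x px]; have [a ax] := nil_chart_exists x.
by exists a, x; split=> //; exact: eq_exist.
Qed.

Lemma nil_hausdorff (p q : nilmfd) : p <> q -> exists (a b : nil_chart) x y,
  [/\ nil_dom a x, nil_proj x = p, nil_dom b y, nil_proj y = q &
   exists A B, [/\ nbhs x A, nbhs y B &
     forall z w, A z -> B w -> nil_proj z <> nil_proj w]].
Proof.
have [a [x [ax <-]]] := nil_cover p; have [b [y [bY <-]]] := nil_cover q.
move=> pq; exists a, b, x, y; split=> //.
have [[A B] [/= Ax Bx] AB] := Gamma_near x y.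
exists A, B; split=> // z w Az Bw /nil_proj_eq G; apply: pq; apply/nil_proj_eq.
by have /= <- := AB (z, w) (conj Az Bw) G.
Qed.

Lemma nil_transition (a b : nil_chart) x y : nil_dom a x -> nil_dom b y ->
  nil_proj x = nil_proj y -> exists (U : set V) (f : V -> V),
    [/\ open U /\ U x, U `<=` nil_dom a,
        forall i, smooth_on U (fun z => f z 0 i) &
        forall z, U z -> [/\ nil_dom b (f z), nil_proj (f z) = nil_proj z &
          forall u v, inner (nil_metric z) u v =
            inner (nil_metric (f z)) (vderive u f z) (vderive v f z)]].
Proof.
move=> ax bY /nil_proj_eq G; pose p := nil_mul y (- x).
have px : nil_mul p x = y by rewrite -nil_mulA nil_mulNx nil_mulx0.
have pc : continuous (nil_mul p).
  move=> z A /nbhs_ballP[e /= e0 eA].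
  have : \forall w \near z, forall i, ball (nil_mul p z 0 i) e (nil_mul p w 0 i).
    apply: (@filter_forall _ _ (fun i w =>
      ball (nil_mul p z 0 i) e (nil_mul p w 0 i)) (nbhs z)) => i.
    have cz := differentiable_continuous (@mul_smooth setT p i [::] z I).
    by apply: cz; exact: nbhsx_ballx.
  apply: filterS => w Bw; apply: eA; split=> // i k; rewrite (ord1 i).
  exact: Bw.
exists (nil_dom a `&` nil_mul p @^-1` nil_dom b), (nil_mul p); split.
- split; last by split=> //=; rewrite px.
  apply: openI; first exact: nil_dom_open.
  by apply: open_comp => [z _|]; [exact: pc|exact: nil_dom_open].
- by move=> z [].
- by move=> i; exact: mul_smooth.
- move=> z [_ bz]; split=> //; last by move=> u v; exact: inner_translate.
  have zE : z = nil_mul (- p) (nil_mul p z).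
    by rewrite nil_mulA nil_mulNx nil_mul0x.
  apply/nil_proj_eq; rewrite {1}zE -nil_mulA nil_mulxN nil_mulx0.
  exact: GammaN.
Qed.

Definition nilmanifold : riemannian_manifold R (m + r) :=
  @RiemannianManifold R (m + r) nilmfd nil_chart nil_dom (fun=> nil_proj)
    (fun=> nil_metric) nil_dom_open nil_dom_inj nil_cover nil_hausdorff
    (fun _ x _ => nil_metric_sym x) (fun _ x v _ => @nil_metric_gt0 x v)
    (fun a => @nil_metric_smooth (nil_dom a)) nil_transition.

End Lattice.
End NilpotentGroup.
Arguments nilmanifold {R m r} j j_int.

Definition mx5 (R : realType) (rows : seq (seq R)) : 'M[R]_5 :=
  \matrix_(a, b) nth 0 (nth [::] rows a) b.

Definition j_fun (R : realType) (Z : 'rV[R]_3) : 'M[R]_5 :=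
  let c1 := Z 0 0 in let c2 := Z 0 1 in let c3 := Z 0 2 in mx5
  [:: [::   0;   0;   0; -c3;  c2];
      [::   0;   0;  c3;   0; -c1];
      [::   0; -c3;   0;   0;   0];
      [::  c3;   0;   0;   0;   0];
      [:: -c2;  c1;   0;   0;   0]].

Definition j'_fun (R : realType) (Z : 'rV[R]_3) : 'M[R]_5 :=
  let c1 := Z 0 0 in let c2 := Z 0 1 in let c3 := Z 0 2 in mx5
  [:: [::   0; -c3;   0;   0;   0];
      [::  c3;   0;   0;   0;   0];
      [::   0;   0;   0; -c3;  c2];
      [::   0;   0;  c3;   0; -c1];
      [::   0;   0; -c2;  c1;   0]].

Ltac mx5_cases := case=> [[|[|[|[|[|//]]]]] ?] [[|[|[|[|[|//]]]]] ?].

Lemma j_linear (R : realType) : linear (@j_fun R).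
Proof.
by move=> t Z Z'; apply/matrixP; mx5_cases; rewrite !mxE /= ?mxE; ring.
Qed.

Lemma j_skew (R : realType) (Z : 'rV[R]_3) : (j_fun Z)^T = - j_fun Z.
Proof. by apply/matrixP; mx5_cases; rewrite !mxE /=; ring. Qed.

Lemma j'_linear (R : realType) : linear (@j'_fun R).
Proof.
by move=> t Z Z'; apply/matrixP; mx5_cases; rewrite !mxE /= ?mxE; ring.
Qed.

Lemma j'_skew (R : realType) (Z : 'rV[R]_3) : (j'_fun Z)^T = - j'_fun Z.
Proof. by apply/matrixP; mx5_cases; rewrite !mxE /=; ring. Qed.

Definition jmap (R : realType) : so_map R 5 3 := SoMap (@j_linear R) (@j_skew R).

Definition jmap' (R : realType) : so_map R 5 3 :=
  SoMap (@j'_linear R) (@j'_skew R).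

Lemma brv_int (R : realType) m r (f : so_map R m r) (X Y : 'rV[R]_m) :
  (forall k a b, f (evec k) a b \is a Num.int) ->
  intvec X -> intvec Y -> intvec (brv f X Y).
Proof.
move=> fi Xi Yi k; rewrite brvE; apply: rpred_sum => a _.
by apply: rpred_sum => b _; rewrite !rpredM.
Qed.

Lemma j_int (R : realType) (X Y : 'rV[R]_5) :
  intvec X -> intvec Y -> intvec (brv (jmap R) X Y).
Proof.
apply: brv_int => k; mx5_cases; rewrite !mxE /= ?rpredN ?rpred0 ?mxE ?natr_int //.
all: by rewrite rpred_nat.
Qed.

Lemma j'_int (R : realType) (X Y : 'rV[R]_5) :
  intvec X -> intvec Y -> intvec (brv (jmap' R) X Y).
Proof.
apply: brv_int => k; mx5_cases; rewrite !mxE /= ?rpredN ?rpred0 ?mxE ?natr_int //.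
all: by rewrite rpred_nat.
Qed.

(* Main.v *)
From HB Require Import structures.
Require Import Defs.
From mathcomp Require Import all_boot all_order all_algebra reals.
From mathcomp Require Import ring lra.
From mathcomp Require Import boolp classical_sets functions topology normedtype.
From mathcomp Require Import derive.
Set Implicit Arguments.
Unset Strict Implicit.
Unset Printing Implicit Defensive.
Import Order.TTheory GRing.Theory Num.Theory.
Import numFieldNormedType.Exports.
Local Open Scope classical_set_scope.
Local Open Scope ring_scope.

(** The metric of [nilmanifold j] is, in every chart, the left invariant metric
in exponential coordinates. Identify the tangent space at [x] with the Lie
algebra by left translation ([pull]). The Levi-Civita connection then becomes
the flat derivative plus the bilinear map [conn] given by the Koszul formula
([nabla_left_field]), so that the components at [x] of the curvature, of the
Ricci tensor and of its covariant derivative are the values at the translated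
vectors of tensors on the Lie algebra which do not depend on [x] ([curv_cst],
[ric_coordE], [nabla_ric_coordE]).

The four invariants are complete contractions of these tensors. An orthonormal
basis of the tangent space is translated to an orthonormal basis of the Lie
algebra, and the trace of a bilinear form is the same in all orthonormal bases
([trace_orthonormal]). Therefore each invariant is the same polynomial in the
structure constants at every point, in every chart and for every basis.

For both Lie algebras the Ricci tensor is diagonal in the standard basis, say
with eigenvalues rho_a, so the invariants are
- sum rho_a rho_b R_abab,
- sum rho_a R_acdk^2,
- sum N_abc N_cab and sum N_abc^2, where N_cab = G_cab (rho_a - rho_b) and
  G_cab are the connection coefficients.
The structure constants are integers, and so are twice the eigenvalues and the
connection coefficients and four times the curvature components. An evaluation
in the integers yields -7, -21/2, -5, 11 for j and -59/8, -43/4, -43/8, 43/4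
for j'. *)

(** * Derivatives, bilinear forms and traces *)

(** Brackets of brackets vanish, which keeps everything that has to be
differentiated at degree at most two along each line: the derivative can be
read off such an expansion. *)
Lemma derive_quadratic (R : realType) n (W : normedModType R)
    (f : 'rV[R]_n -> W) (u x : 'rV[R]_n) A B :
  (forall h, f (h *: u + x) = f x + h *: A + h ^+ 2 *: B) -> 'D_u f x = A.
Proof.
move=> fE; apply: cvg_lim => //.
apply: (@cvg_trans _ ((fun h : R => A + h *: B) @ 0^')).
  apply: near_eq_cvg; near=> h.
  have h0 : h != 0 by near: h; exact: nbhs_dnbhs_neq.
  rewrite /= fE -(addrA (f x)) (addrC (f x)) addrK scalerDr !scalerA mulVf// scale1r.
  by rewrite expr2 mulrA mulVf// mul1r.
have {2}-> : A = A + 0 *: B by rewrite scale0r addr0.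
apply: cvgD; first exact: cvg_cst.
by apply: cvgZr_tmp; apply: nbhs_dnbhs.
Unshelve. all: by end_near. Qed.

Section EuclideanSpace.
Context {R : realType} {n : nat}.
Local Notation V := 'rV[R]_n.
Implicit Types (u v w : V).

Lemma dotv_linearl w : scalar (fun u => dotv u w).
Proof. by move=> a u v; rewrite /dotv mulmxDl -scalemxAl !mxE. Qed.

Lemma dotv_linearr u : scalar (dotv u).
Proof. by move=> a v w; rewrite !(dotvC u); exact: dotv_linearl. Qed.

Lemma dotvDl u v w : dotv (u + v) w = dotv u w + dotv v w.
Proof. by have := dotv_linearl w 1 u v; rewrite scale1r mul1r. Qed.

Lemma dotvDr u v w : dotv u (v + w) = dotv u v + dotv u w.
Proof. by rewrite !(dotvC u) dotvDl. Qed.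

Lemma dotvZl a u v : dotv (a *: u) v = a * dotv u v.
Proof. by rewrite /dotv -scalemxAl mxE. Qed.

Lemma dotvZr a u v : dotv u (a *: v) = a * dotv u v.
Proof. by rewrite !(dotvC u) dotvZl. Qed.

Lemma dotvNl u v : dotv (- u) v = - dotv u v.
Proof. by rewrite -scaleN1r dotvZl mulN1r. Qed.

Lemma dotvNr u v : dotv u (- v) = - dotv u v.
Proof. by rewrite !(dotvC u) dotvNl. Qed.

Definition dotvE := (dotvDl, dotvDr, dotvZl, dotvZr, dotvNl, dotvNr).

Lemma dotv_evec u k : dotv u (evec k) = u 0 k.
Proof. by rewrite /dotv trmx_delta -colE mxE. Qed.

Lemma scalarE (f : V -> R) u : scalar f -> \sum_a u 0 a * f (evec a) = f u.
Proof.
move=> fl; pose L := @GRing.isLinear.Build R V R _ f fl.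
pose f' : {scalar V} := HB.pack f L.
rewrite -[RHS]/(f' u) {2}(row_sum_delta u) linear_sum.
by apply: eq_bigr => a _; rewrite linearZ.
Qed.

Lemma scalarB (f : V -> R) u v : scalar f -> f (u - v) = f u - f v.
Proof. by move=> fl; rewrite -scaleN1r addrC fl mulN1r addrC. Qed.

Lemma scalar_sum (I : finType) (F : I -> V -> R) :
  (forall i, scalar (F i)) -> scalar (fun u => \sum_i F i u).
Proof.
move=> Fl a u v; rewrite mulr_sumr -big_split; apply: eq_bigr => i _.
exact: Fl.
Qed.

Lemma scalar_mulr f c : scalar f -> scalar (fun u : V => f u * c).
Proof. by move=> fl a u v; rewrite fl mulrDl mulrA. Qed.

Lemma scalar_mull f c : scalar f -> scalar (fun u : V => c * f u).
Proof. by move=> fl a u v; rewrite fl mulrDr mulrCA. Qed.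

Definition bilinear_form (f : V -> V -> R) :=
  (forall v, scalar (f^~ v)) /\ (forall u, scalar (f u)).

Lemma bilinearE f u v : bilinear_form f ->
  \sum_a \sum_b u 0 a * v 0 b * f (evec a) (evec b) = f u v.
Proof.
move=> [fl fr]; rewrite -(scalarE u (fl v)); apply: eq_bigr => a _.
by rewrite -(scalarE v (fr _)) mulr_sumr; apply: eq_bigr => b _; rewrite mulrA.
Qed.

(** The rows of [E] form an orthonormal basis for the inner product [G] exactly
when the inverse of [G] is [E^T *m E]. *)
Lemma trace_orthonormal_metric (G E : 'M[R]_n) f : E *m G *m E^T = 1%:M ->
  bilinear_form f ->
  \sum_a \sum_b invmx G a b * f (evec a) (evec b) =
  \sum_k f (row k E) (row k E).
Proof.
move=> EGE fb; have EtEG : E^T *m E *m G = 1%:M.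
  by rewrite -mulmxA; exact: mulmx1C.
have Gu : G \in unitmx by case/mulmx1_unit: EtEG.
have -> : invmx G = E^T *m E by rewrite -[RHS]mulmx1 -(mulmxV Gu) mulmxA EtEG mul1mx.
under [RHS]eq_bigr do rewrite -(bilinearE _ _ fb).
rewrite [RHS]exchange_big; apply: eq_bigr => a _ /=.
rewrite [RHS]exchange_big; apply: eq_bigr => b _ /=.
by rewrite mxE mulr_suml; apply: eq_bigr => k _; rewrite !mxE.
Qed.

Lemma trace_orthonormal (Q : 'M[R]_n) f : Q *m Q^T = 1%:M ->
  bilinear_form f ->
  \sum_k f (row k Q) (row k Q) = \sum_k f (evec k) (evec k).
Proof.
move=> QQ fb; rewrite -(@trace_orthonormal_metric 1%:M) ?mulmx1// invmx1.
apply: eq_bigr => a _; rewrite (bigD1 a)//= mxE eqxx mul1r big1 ?addr0// => b ba.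
by rewrite mxE eq_sym (negbTE ba) mul0r.
Qed.

Lemma dotv_inj u v : (forall w, dotv u w = dotv v w) -> u = v.
Proof. by move=> E; apply/rowP => k; rewrite -!dotv_evec. Qed.

End EuclideanSpace.

Ltac multilinear :=
  split=> ?; repeat (apply: scalar_sum => ?);
  repeat first [apply: scalar_mulr | apply: scalar_mull].

(** Lowering the index cancels the inverse metric, so no inverse of [g x] has to
be known. *)
Lemma inner_christoffel (R : realType) n (g : 'rV[R]_n -> 'M[R]_n) a b t x :
  (g x)^T = g x -> g x \in unitmx ->
  inner (g x) (\row_l christoffel g l a b x) (evec t) = 2^-1 *
    (partial a (fun y => g y t b) x + partial b (fun y => g y t a) x
     - partial t (fun y => g y a b) x).
Proof.
move=> gT gu; pose K := \row_s (partial a (fun y => g y s b) x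
  + partial b (fun y => g y s a) x - partial s (fun y => g y a b) x).
have -> : \row_l christoffel g l a b x = 2^-1 *: (K *m (invmx (g x))^T).
  apply/rowP => l; rewrite !mxE /christoffel; congr (_ * _).
  by apply: eq_bigr => s _; rewrite !mxE mulrC.
rewrite /inner -scalemxAl -(mulmxA K) -{2}gT -trmx_mul mulmxV// trmx1 mulmx1.
by rewrite -scalemxAl mxE -[X in _ * X]/(dotv K (evec t)) dotv_evec mxE.
Qed.

(** * Tensors with integral structure constants *)

(** A sum that evaluates, unlike the opaque [\sum]. *)
Definition isum n (F : nat -> int) : int :=
  foldr (fun i s => F i + s) 0 (iota 0 n).

Lemma isumE (R : realType) n (F : nat -> int) (G : 'I_n -> R) :
  (forall i, G i = (F i)%:~R) -> \sum_i G i = (isum n F)%:~R.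
Proof.
move=> GF; rewrite (eq_bigr _ (fun i _ => GF i)).
rewrite -(big_mkord xpredT (fun i => (F i)%:~R)).
rewrite -rmorph_sum /isum /index_iota subn0; congr (_%:~R).
by elim: (iota _ _) => [|i s IHs] /=; rewrite ?big_nil// big_cons IHs.
Qed.

(** The tensors of a metric Lie algebra of dimension [n] with integral structure
constants [C a b c], the component on [e_c] of the bracket of [e_a] and [e_b].
Denominators are cleared: the connection coefficients and the Ricci eigenvalues
[rho] are doubled, the components of the curvature, of the Ricci tensor and of
its covariant derivative are multiplied by four. *)
Section IntegralModel.
Context (n : nat) (C : nat -> nat -> nat -> int) (rho : nat -> int).

Definition conn_int a b c : int := C a b c - C b c a + C c a b.

Definition riemann_int a b c d : int := isum n (fun k =>
  2 * C a b k * conn_int k c d - conn_int b c k * conn_int a k d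
  + conn_int a c k * conn_int b k d).

Definition ricci_int a b : int := isum n (fun k => riemann_int a k b k).

Definition nabla_ricci_int c a b : int := conn_int c a b * (rho a - rho b).

Definition diagonal_ricci : bool :=
  all (fun a => all (fun b =>
    ricci_int a b == if a == b then 2 * rho a else 0) (iota 0 n)) (iota 0 n).

Definition ric_ric_R_int : int := isum n (fun a => isum n (fun b =>
  rho a * rho b * riemann_int a b a b)).

Definition ric_R_R_int : int := isum n (fun a =>
  isum n (fun c => isum n (fun d => isum n (fun k =>
    rho a * (riemann_int a c d k * riemann_int a c d k))))).

Definition nabla_ric_nabla_ric_int : int := isum n (fun a => isum n (fun b =>
  isum n (fun c => nabla_ricci_int a b c * nabla_ricci_int c a b))).

Definition norm2_nabla_ric_int : int := isum n (fun a => isum n (fun b =>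
  isum n (fun c => nabla_ricci_int a b c * nabla_ricci_int a b c))).

End IntegralModel.

(** * The Lie algebra: connection and curvature *)

(** The transpose, for the inner product, of the endomorphism [br j u]. *)
Definition coad (R : realType) m r (j : so_map R m r) (u v : 'rV[R]_(m + r)) :
  'rV[R]_(m + r) := row_mx (lsubmx u *m (j (rsubmx v))^T) 0.

(** The Levi-Civita connection on left invariant fields. It is locked because
its body is itself a linear combination, which the rules of bilinearity would
rewrite. *)
HB.lock Definition conn (R : realType) m r (j : so_map R m r)
  (u v : 'rV[R]_(m + r)) : 'rV[R]_(m + r) :=
    2^-1 *: (br j u v - coad j u v - coad j v u).

(** The left translation of the tangent space at [x] to the origin, that is, the
differential at [x] of the translation by [- x]. *)
HB.lock Definition pull (R : realType) m r (j : so_map R m r)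
  (x v : 'rV[R]_(m + r)) : 'rV[R]_(m + r) := v - 2^-1 *: br j x v.

(** The vectors are made variables before the call of [field], which would
otherwise compare the coordinates of distinct brackets by unfolding them. *)
Ltac vector_field :=
  repeat match goal with
  | |- context [@conn ?R ?m ?r ?j ?u ?v] => move: (@conn R m r j u v) => ?
  | |- context [coad ?j ?u ?v] => move: (coad j u v) => ?
  | |- context [br ?j ?u ?v] => move: (br j u v) => ?
  end;
  apply/rowP => ?; rewrite !mxE; field.

Section TwoStep.
Context {R : realType} {m r : nat} (j : so_map R m r).
Local Notation V := 'rV[R]_(m + r).
Local Notation br := (br j).
Local Notation coad := (coad j).
Local Notation conn := (conn j).
Local Notation pull := (pull j).
Local Notation g := (nil_metric j).
Local Notation e k := (evec k : V).
Implicit Types u v w x y z : V.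

Lemma dotv_coad u v w : dotv (coad u v) w = dotv v (br u w).
Proof.
have E k l (a c : 'rV[R]_k) (b d : 'rV[R]_l) :
    dotv (row_mx a b) (row_mx c d) = dotv a c + dotv b d.
  by rewrite /dotv tr_row_mx mul_row_col mxE.
rewrite -[w in LHS]hsubmxK -[X in _ = dotv X _]hsubmxK !E brvP.
have dotv0 k (a : 'rV[R]_k) : dotv 0 a = 0 by rewrite /dotv mul0mx mxE.
by rewrite (dotvC _ 0) !dotv0 addr0 add0r.
Qed.

Lemma coadDl u u' v : coad (u + u') v = coad u v + coad u' v.
Proof. by rewrite /coad linearD mulmxDl add_row_mx addr0. Qed.

Lemma coadZl a u v : coad (a *: u) v = a *: coad u v.
Proof. by rewrite /coad linearZ -scalemxAl scale_row_mx scaler0. Qed.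

Lemma coadDr u v v' : coad u (v + v') = coad u v + coad u v'.
Proof. by apply: dotv_inj => w; rewrite dotvDl !dotv_coad dotvDl. Qed.

Lemma coadZr a u v : coad u (a *: v) = a *: coad u v.
Proof. by apply: dotv_inj => w; rewrite dotvZl !dotv_coad dotvZl. Qed.

Lemma coad_brl u v w : coad (br u v) w = 0.
Proof. by rewrite /coad /Defs.br row_mxKl mul0mx row_mx0. Qed.

Lemma connDl u u' v : conn (u + u') v = conn u v + conn u' v.
Proof. by rewrite conn.unlock brDl coadDl coadDr; vector_field. Qed.

Lemma connDr u v v' : conn u (v + v') = conn u v + conn u v'.
Proof. by rewrite conn.unlock brDr coadDl coadDr; vector_field. Qed.

Lemma connZl a u v : conn (a *: u) v = a *: conn u v.
Proof. by rewrite conn.unlock brZl coadZl coadZr; vector_field. Qed.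

Lemma connZr a u v : conn u (a *: v) = a *: conn u v.
Proof. by rewrite conn.unlock brZr coadZl coadZr; vector_field. Qed.

Lemma connNl u v : conn (- u) v = - conn u v.
Proof. by rewrite -scaleN1r connZl scaleN1r. Qed.

Lemma connNr u v : conn u (- v) = - conn u v.
Proof. by rewrite -scaleN1r connZr scaleN1r. Qed.

Definition connE := (connDl, connDr, connZl, connZr, connNl, connNr).

Lemma conn_br u v u' v' : conn (br u v) (br u' v') = 0.
Proof. by rewrite conn.unlock br_brl !coad_brl !subr0 scaler0. Qed.

(** The derivatives of inner products are absent from this Koszul formula since
left invariant fields have constant inner products. *)
Lemma koszul u v w : dotv (conn u v) w =
  2^-1 * (dotv (br u v) w - dotv (br v w) u + dotv (br w u) v).
Proof.
rewrite conn.unlock !dotvE !dotv_coad (br_anti _ w u) dotvNl !(dotvC (br _ w)).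
by ring.
Qed.

Lemma conn_skew u v w : dotv (conn u v) w = - dotv (conn u w) v.
Proof.
by rewrite !koszul (br_anti _ w v) (br_anti _ u w) (br_anti _ v u) !dotvE; field.
Qed.

Definition curvature u v w : V :=
  conn (br u v) w - (conn u (conn v w) - conn v (conn u w)).

Definition riemann u v w z : R := dotv (curvature u v w) z.

Definition ricci u v : R := \sum_k riemann u (evec k) v (evec k).

(** The Ricci tensor of a left invariant metric is left invariant, so only its
arguments are differentiated. *)
Definition nabla_ricci w u v : R := - ricci (conn w u) v - ricci u (conn w v).

Lemma curvature_linear1 v w : linear (fun u => curvature u v w).
Proof. by move=> a u u'; rewrite /curvature !(brE, connE); vector_field. Qed.

Lemma curvature_linear2 u w : linear (fun v => curvature u v w).
Proof. by move=> a v v'; rewrite /curvature !(brE, connE); vector_field. Qed.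

Lemma curvature_linear3 u v : linear (fun w => curvature u v w).
Proof. by move=> a w w'; rewrite /curvature !(brE, connE); vector_field. Qed.

Lemma riemann_linear1 v w z : scalar (fun u => riemann u v w z).
Proof. by move=> a u u'; rewrite /riemann curvature_linear1 dotv_linearl. Qed.

Lemma riemann_linear2 u w z : scalar (fun v => riemann u v w z).
Proof. by move=> a v v'; rewrite /riemann curvature_linear2 dotv_linearl. Qed.

Lemma riemann_linear3 u v z : scalar (fun w => riemann u v w z).
Proof. by move=> a w w'; rewrite /riemann curvature_linear3 dotv_linearl. Qed.

Lemma riemann_linear4 u v w : scalar (riemann u v w).
Proof. exact: dotv_linearr. Qed.

Lemma ricci_bilinear : bilinear_form ricci.
Proof.
by split=> u; apply: scalar_sum => k; [exact: riemann_linear1|exact: riemann_linear3].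
Qed.

Lemma nabla_ricci_linear1 u v : scalar (fun w => nabla_ricci w u v).
Proof.
have [rl rr] := ricci_bilinear.
by move=> a w w'; rewrite /nabla_ricci !connDl !connZl (rl v) (rr u); ring.
Qed.

Lemma nabla_ricci_linear2 w v : scalar (fun u => nabla_ricci w u v).
Proof.
have [rl _] := ricci_bilinear.
by move=> a u u'; rewrite /nabla_ricci !connDr !connZr !rl; ring.
Qed.

Lemma nabla_ricci_linear3 w u : scalar (nabla_ricci w u).
Proof.
have [_ rr] := ricci_bilinear.
by move=> a v v'; rewrite /nabla_ricci !connDr !connZr !rr; ring.
Qed.

(** * The metric in the left trivialisation *)

Lemma pull_linear x : linear (pull x).
Proof. by move=> a u v; rewrite pull.unlock !brE; vector_field. Qed.

HB.instance Definition _ x := GRing.isLinear.Build R V V _ (pull x) (pull_linear x).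

Lemma left_fieldK x u : pull x (left_field j u x) = u.
Proof. by rewrite left_fieldE pull.unlock !brE scaler0 addr0 addrK. Qed.

Lemma pullK x v : left_field j (pull x v) x = v.
Proof. by rewrite left_fieldE pull.unlock !brE scaler0 subr0 subrK. Qed.

Lemma pull_inj x : injective (pull x).
Proof. exact: can_inj (pullK x). Qed.

(** Translation only changes the central part of a vector. *)
Lemma br_pull x y u v : br (pull x u) (pull y v) = br u v.
Proof. by rewrite pull.unlock !brE !(scaler0, subr0). Qed.

Lemma pull_translate h u x v :
  pull (h *: u + x) v = pull x v + h *: (- 2^-1 *: br u v).
Proof. by rewrite pull.unlock !brE; vector_field. Qed.

Lemma metricE x u v : inner (g x) u v = dotv (pull x u) (pull x v).
Proof. by rewrite pull.unlock; exact: inner_metricE. Qed.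

Lemma metric_coordE x a b : g x a b = dotv (pull x (evec a)) (pull x (evec b)).
Proof. by rewrite pull.unlock; exact: nil_metricE. Qed.

Lemma dotv_pull_inj x u v :
  (forall t, dotv u (pull x (evec t)) = dotv v (pull x (evec t))) -> u = v.
Proof.
move=> E; apply: dotv_inj => w.
have sc z : scalar (fun w => dotv z (pull x w)).
  by move=> a y y'; rewrite linearP; exact: dotv_linearr.
rewrite -(left_fieldK x w) -(scalarE _ (sc u)) -(scalarE _ (sc v)).
by apply: eq_bigr => t _; rewrite E.
Qed.

Lemma metric_unit x : g x \in unitmx.
Proof.
have := left_field_orthonormal j x; rewrite /orthonormal => /mulmx1C.
by rewrite mulmxA => /mulmx1_unit[].
Qed.

Lemma partial_metric s a b x : partial s (fun y => g y a b) x =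
  - 2^-1 * (dotv (br (evec s) (evec a)) (pull x (evec b)) +
            dotv (pull x (evec a)) (br (evec s) (evec b))).
Proof.
have -> : (fun y => g y a b) = fun y => dotv (pull y (evec a)) (pull y (evec b)).
  by apply/funext => y; exact: metric_coordE.
pose B := 2^-1 ^+ 2 *
  dotv (br (evec s) (evec a)) (br (evec s) (evec b)).
apply: (@derive_quadratic _ _ R _ _ _ _ B) => h.
by rewrite !pull_translate /B !dotvE /GRing.scale /=; field.
Qed.

(** The Koszul formula for coordinate fields has only the derivatives of the
metric, that for left invariant fields only the brackets: the translated
Christoffel symbols are the symmetric part of [conn]. *)
Lemma pull_christoffel a b x : pull x (\row_l christoffel g l a b x) =
  conn (pull x (evec a)) (pull x (evec b)) - 2^-1 *: br (evec a) (evec b).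
Proof.
apply: (dotv_pull_inj (x := x)) => t; rewrite -metricE.
rewrite (inner_christoffel _ _ _ (nil_metric_sym j x) (metric_unit x)).
rewrite !partial_metric dotvDl dotvNl dotvZl koszul !br_pull.
rewrite (br_anti _ (evec t)) (br_anti _ (evec b) (evec a)).
rewrite (br_anti _ (evec t) (evec b)) !dotvE.
rewrite !(dotvC (pull x _) (br _ _)).
by field.
Qed.

Lemma christoffel_form x u v :
  \row_l \sum_a \sum_b u 0 a * v 0 b * christoffel g l a b x =
  left_field j (conn (pull x u) (pull x v) - 2^-1 *: br u v) x.
Proof.
apply: (@pull_inj x); rewrite left_fieldK.
apply: dotv_inj => w.
pose f u v := dotv (conn (pull x u) (pull x v) - 2^-1 *: br u v) w.
have fb : bilinear_form f.
  by split=> z a y y'; rewrite /f linearP !(brE, connE, dotvE); ring.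
rewrite -[RHS]/(f u v) -(bilinearE u v fb).
have -> : \row_l \sum_a \sum_b u 0 a * v 0 b * christoffel g l a b x =
    \sum_a \sum_b (u 0 a * v 0 b) *: \row_l christoffel g l a b x.
  apply/rowP => l; rewrite mxE summxE; apply: eq_bigr => a _.
  by rewrite summxE; apply: eq_bigr => b _; rewrite !mxE.
rewrite linear_sum /dotv mulmx_suml summxE; apply: eq_bigr => a _.
rewrite linear_sum mulmx_suml summxE; apply: eq_bigr => b _.
by rewrite linearZ -scalemxAl mxE /f -pull_christoffel.
Qed.

(** The derivative of the field [left_field j (f y) y] contributes half of the
bracket of [X x] and [f x], which is the antisymmetric part of [conn] and
completes the symmetric part coming from the Christoffel symbols. *)
Lemma nabla_left_field (X : V -> V) (f : V -> V) x A :
  (forall h, f (h *: X x + x) = f x + h *: A) ->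
  nabla g X (fun y => left_field j (f y) y) x =
  left_field j (A + conn (pull x (X x)) (f x)) x.
Proof.
move=> fA; rewrite /nabla christoffel_form left_fieldK.
have -> : vderive (X x) (fun y => left_field j (f y) y) x =
    A + 2^-1 *: br (X x) (f x) + 2^-1 *: br x A.
  apply: (derive_quadratic (B := 2^-1 *: br (X x) A)) => h.
  by rewrite !left_fieldE fA !brE; vector_field.
by rewrite !left_fieldE !(brE, br0r); vector_field.
Qed.

Lemma nabla_cst u v x : nabla g (cst u) (cst v) x =
  left_field j (conn (pull x u) (pull x v) - 2^-1 *: br u v) x.
Proof.
have -> : cst v = fun y => left_field j (pull y v) y.
  by apply/funext => y; rewrite pullK.
rewrite (nabla_left_field (A := - 2^-1 *: br u v)) => [|h].
  by congr (left_field j _ x); vector_field.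
exact: pull_translate.
Qed.

(** Coordinate fields commute, but their translates [pull y u] vary with [y]; the
terms that this variation adds to the two second covariant derivatives
combine into [conn (br u v) w]. *)
Lemma curv_cst u v w x : curv g (cst u) (cst v) (cst w) x =
  left_field j (curvature (pull x u) (pull x v) (pull x w)) x.
Proof.
have nabla2 a b : nabla g (cst a) (nabla g (cst b) (cst w)) x = left_field j
    (- 2^-1 *: conn (br a b) (pull x w) - 2^-1 *: conn (pull x b) (br a w)
     + conn (pull x a) (conn (pull x b) (pull x w) - 2^-1 *: br b w)) x.
  have -> : nabla g (cst b) (cst w) =
      fun y => left_field j (conn (pull y b) (pull y w) - 2^-1 *: br b w) y.
    by apply/funext => y; exact: nabla_cst.
  apply: nabla_left_field => h.
  rewrite !pull_translate !connE conn_br.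
  by vector_field.
have lie0 : lie (cst u) (cst v) = cst 0.
  by apply/funext => y; rewrite /lie /vderive !derive_cst subrr.
have conn0l y : conn 0 y = 0 by rewrite -[X in conn X _](scale0r 0) connZl scale0r.
have left_field_comb p q s t : p - (q - s) = t ->
    left_field j p x - (left_field j q x - left_field j s x) = left_field j t x.
  by move=> <-; rewrite !left_fieldE !brE; vector_field.
rewrite /curv !nabla2 lie0 nabla_cst; apply: left_field_comb.
rewrite linear0 br0l conn0l /curvature br_pull !connE (br_anti _ v u) !connE.
by vector_field.
Qed.

Lemma scalar_pull x (f : V -> R) : scalar f -> scalar (fun u => f (pull x u)).
Proof. by move=> fl a u v; rewrite linearP fl. Qed.

Lemma curv_coordE a b c d x : curv_coord g a b c d x =
  riemann (pull x (evec a)) (pull x (evec b)) (pull x (evec c)) (pull x (evec d)).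
Proof. by rewrite /curv_coord curv_cst metricE left_fieldK. Qed.

Lemma curv_tensorE x u v w z : curv_tensor g x u v w z =
  riemann (pull x u) (pull x v) (pull x w) (pull x z).
Proof.
rewrite -(scalarE u (scalar_pull x (riemann_linear1 _ _ _))); apply: eq_bigr => a _.
rewrite -(scalarE v (scalar_pull x (riemann_linear2 _ _ _))) mulr_sumr.
apply: eq_bigr => b _.
rewrite -(scalarE w (scalar_pull x (riemann_linear3 _ _ _))) !mulr_sumr.
apply: eq_bigr => c _.
rewrite -(scalarE z (scalar_pull x (riemann_linear4 _ _ _))) !mulr_sumr.
by apply: eq_bigr => d _; rewrite curv_coordE !mulrA.
Qed.

Lemma ric_coordE a b x :
  ric_coord g a b x = ricci (pull x (evec a)) (pull x (evec b)).
Proof.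
pose f u v := riemann (pull x (evec a)) (pull x u) (pull x (evec b)) (pull x v).
have fb : bilinear_form f.
  split=> u; [exact: (scalar_pull x (riemann_linear2 _ _ _))|].
  exact: (scalar_pull x (riemann_linear4 _ _ _)).
transitivity (\sum_c \sum_d invmx (g x) c d * f (evec c) (evec d)).
  by apply: eq_bigr => c _; apply: eq_bigr => d _; rewrite curv_coordE.
rewrite (trace_orthonormal_metric (left_field_orthonormal j x) fb).
by apply: eq_bigr => k _; rewrite /f rowK left_fieldK.
Qed.

(** Along [evec c] a translated vector [pull x (evec a)] varies by half of a
bracket, which turns the symmetric part of [conn] in the Christoffel terms into
all of [conn]. *)
Lemma nabla_ric_coordE c a b x : nabla_ric_coord g c a b x =
  nabla_ricci (pull x (evec c)) (pull x (evec a)) (pull x (evec b)).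
Proof.
have [rl rr] := ricci_bilinear.
pose ad a := - 2^-1 *: br (evec c) (evec a).
have -> : nabla_ric_coord g c a b x =
    ricci (ad a) (pull x (evec b)) + ricci (pull x (evec a)) (ad b)
    - ricci (pull x (\row_s christoffel g s c a x)) (pull x (evec b))
    - ricci (pull x (evec a)) (pull x (\row_s christoffel g s c b x)).
  have Rl := scalar_pull x (rl (pull x (evec b))).
  have Rr := scalar_pull x (rr (pull x (evec a))).
  rewrite -(scalarE _ Rl) -(scalarE _ Rr) /nabla_ric_coord.
  congr (_ - _ - _).
  - have -> : ric_coord g a b = fun y => ricci (pull y (evec a)) (pull y (evec b)).
      by apply/funext => y; exact: ric_coordE.
    apply: (@derive_quadratic _ _ R _ _ _ _ (ricci (ad a) (ad b))) => h.
    rewrite !pull_translate -!(addrC (_ *: _)) rl !rr /GRing.scale /=.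
    by ring.
  - by apply: eq_bigr => s _; rewrite mxE ric_coordE.
  - by apply: eq_bigr => s _; rewrite mxE ric_coordE.
have ad_conn d : ad d = pull x (\row_s christoffel g s c d x)
    - conn (pull x (evec c)) (pull x (evec d)).
  by rewrite pull_christoffel /ad; vector_field.
rewrite !ad_conn (scalarB _ _ (rl _)) (scalarB _ _ (rr _)) /nabla_ricci.
by ring.
Qed.

Lemma ric_tensorE x u v : ric_tensor g x u v = ricci (pull x u) (pull x v).
Proof.
have [rl rr] := ricci_bilinear.
rewrite -(bilinearE (f := fun u v => ricci (pull x u) (pull x v))).
  by apply: eq_bigr => a _; apply: eq_bigr => b _; rewrite ric_coordE.
by split=> z; [exact: (scalar_pull x (rl _))|exact: (scalar_pull x (rr _))].
Qed.

Lemma nabla_ric_tensorE x w u v : nabla_ric_tensor g x w u v =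
  nabla_ricci (pull x w) (pull x u) (pull x v).
Proof.
rewrite -(scalarE w (scalar_pull x (nabla_ricci_linear1 _ _))).
apply: eq_bigr => c _.
rewrite -(bilinearE (f := fun u v => nabla_ricci _ (pull x u) (pull x v))).
  rewrite mulr_sumr; apply: eq_bigr => a _; rewrite mulr_sumr.
  by apply: eq_bigr => b _; rewrite nabla_ric_coordE !mulrA.
split=> z; first exact: (scalar_pull x (nabla_ricci_linear2 _ _)).
exact: (scalar_pull x (nabla_ricci_linear3 _ _)).
Qed.

(** * Contractions in an orthonormal basis *)

Section Frame.
Context (x : V) (E : 'M[R]_(m + r)) (Eo : Defs.orthonormal g x E).

Definition pull_frame : 'M[R]_(m + r) := \matrix_k pull x (row k E).
Local Notation Q := pull_frame.
Local Notation q k := (row k Q).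

Lemma pull_frame_orthonormal : Q *m Q^T = 1%:M.
Proof.
by rewrite -Eo; apply/matrixP => a b; rewrite -dotv_row !rowK -metricE inner_row.
Qed.

Lemma RmE : Rm g x E = fun a b c d => riemann (q a) (q b) (q c) (q d).
Proof.
apply/funext => a; apply/funext => b; apply/funext => c; apply/funext => d.
by rewrite /Rm curv_tensorE !rowK.
Qed.

Lemma ric_frameE : ric g x E = fun a b => ricci (q a) (q b).
Proof.
apply/funext => a; apply/funext => b.
by rewrite (ricE _ _ Eo) ric_tensorE !rowK.
Qed.

Lemma nabla_ric_frameE :
  nabla_ric g x E = fun c a b => nabla_ricci (q c) (q a) (q b).
Proof.
apply/funext => c; apply/funext => a; apply/funext => b.
by rewrite /nabla_ric nabla_ric_tensorE !rowK.
Qed.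

Lemma trace_frame f (F : 'I_(m + r) -> R) : bilinear_form f ->
  (forall k, f (e k) (e k) = F k) -> \sum_k f (q k) (q k) = \sum_k F k.
Proof.
move=> fb fF; rewrite (trace_orthonormal pull_frame_orthonormal fb).
exact: eq_bigr.
Qed.

Let rl := ricci_bilinear.1.
Let rr := ricci_bilinear.2.

(** In each of the four contractions every summation index occurs twice, so the
given basis is replaced by the standard one for one index after the other, from
the outermost sum inwards. *)
Lemma ric_ric_R_frame : ric_ric_R g x E =
  \sum_a \sum_b \sum_c \sum_d
    ricci (e a) (e c) * ricci (e b) (e d) * riemann (e a) (e b) (e c) (e d).
Proof.
rewrite /ric_ric_R RmE ric_frameE.
apply: (trace_frame (f := fun u v => \sum_b \sum_c \sum_d
  ricci u (q c) * ricci (q b) (q d) * riemann v (q b) (q c) (q d))) => [|a].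
  by multilinear; [exact: rl|exact: riemann_linear1].
apply: (trace_frame (f := fun u v => \sum_c \sum_d
  ricci (e a) (q c) * ricci u (q d) * riemann (e a) v (q c) (q d))) => [|b].
  by multilinear; [exact: rl|exact: riemann_linear2].
apply: (trace_frame (f := fun u v => \sum_d
  ricci (e a) u * ricci (e b) (q d) * riemann (e a) (e b) v (q d))) => [|c].
  by multilinear; [exact: rr|exact: riemann_linear3].
apply: (trace_frame (f := fun u v =>
  ricci (e a) (e c) * ricci (e b) u * riemann (e a) (e b) (e c) v)) => [|d //].
by multilinear; [exact: rr|exact: riemann_linear4].
Qed.

Lemma ric_R_R_frame : ric_R_R g x E =
  \sum_a \sum_b \sum_c \sum_d \sum_k
    ricci (e a) (e b) * riemann (e a) (e c) (e d) (e k)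
      * riemann (e b) (e c) (e d) (e k).
Proof.
rewrite /ric_R_R RmE ric_frameE.
apply: (trace_frame (f := fun u v => \sum_b \sum_c \sum_d \sum_k
  ricci u (q b) * riemann v (q c) (q d) (q k)
    * riemann (q b) (q c) (q d) (q k))) => [|a].
  by multilinear; [exact: rl|exact: riemann_linear1].
apply: (trace_frame (f := fun u v => \sum_c \sum_d \sum_k
  ricci (e a) u * riemann (e a) (q c) (q d) (q k)
    * riemann v (q c) (q d) (q k))) => [|b].
  by multilinear; [exact: rr|exact: riemann_linear1].
apply: (trace_frame (f := fun u v => \sum_d \sum_k
  ricci (e a) (e b) * riemann (e a) u (q d) (q k)
    * riemann (e b) v (q d) (q k))) => [|c].
  by multilinear; exact: riemann_linear2.
apply: (trace_frame (f := fun u v => \sum_k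
  ricci (e a) (e b) * riemann (e a) (e c) u (q k)
    * riemann (e b) (e c) v (q k))) => [|d].
  by multilinear; exact: riemann_linear3.
apply: (trace_frame (f := fun u v =>
  ricci (e a) (e b) * riemann (e a) (e c) (e d) u
    * riemann (e b) (e c) (e d) v)) => [|k //].
by multilinear; exact: riemann_linear4.
Qed.

Lemma nabla_ric_nabla_ric_frame : nabla_ric_nabla_ric g x E =
  \sum_a \sum_b \sum_c
    nabla_ricci (e a) (e b) (e c) * nabla_ricci (e c) (e a) (e b).
Proof.
rewrite /nabla_ric_nabla_ric nabla_ric_frameE.
apply: (trace_frame (f := fun u v => \sum_b \sum_c
  nabla_ricci u (q b) (q c) * nabla_ricci (q c) v (q b))) => [|a].
  by multilinear; [exact: nabla_ricci_linear1|exact: nabla_ricci_linear2].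
apply: (trace_frame (f := fun u v => \sum_c
  nabla_ricci (e a) u (q c) * nabla_ricci (q c) (e a) v)) => [|b].
  by multilinear; [exact: nabla_ricci_linear2|exact: nabla_ricci_linear3].
apply: (trace_frame (f := fun u v =>
  nabla_ricci (e a) (e b) u * nabla_ricci v (e a) (e b))) => [|c //].
by multilinear; [exact: nabla_ricci_linear3|exact: nabla_ricci_linear1].
Qed.

Lemma norm2_nabla_ric_frame : norm2_nabla_ric g x E =
  \sum_a \sum_b \sum_c nabla_ricci (e a) (e b) (e c) ^+ 2.
Proof.
rewrite /norm2_nabla_ric nabla_ric_frameE.
apply: (trace_frame (f := fun u v => \sum_b \sum_c
  nabla_ricci u (q b) (q c) * nabla_ricci v (q b) (q c))) => [|a].
  by multilinear; exact: nabla_ricci_linear1.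
apply: (trace_frame (f := fun u v => \sum_c
  nabla_ricci (e a) u (q c) * nabla_ricci (e a) v (q c))) => [|b].
  by multilinear; exact: nabla_ricci_linear2.
apply: (trace_frame (f := fun u v =>
  nabla_ricci (e a) (e b) u * nabla_ricci (e a) (e b) v)) => [|c //].
by multilinear; exact: nabla_ricci_linear3.
Qed.

End Frame.

(** * Evaluation with integral structure constants *)

Section StructureConstants.
Local Notation n := (m + r)%N.
Context (C : nat -> nat -> nat -> int) (rho : nat -> int).
Context (CE : forall a b k : 'I_n, br (e a) (e b) 0 k = (C a b k)%:~R).

Lemma conn_evec (a b k : 'I_n) :
  dotv (conn (e a) (e b)) (e k) = 2^-1 * (conn_int C a b k)%:~R.
Proof. by rewrite koszul !dotv_evec !CE /conn_int intrD intrB. Qed.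

Lemma riemann_evec (a b c d : 'I_n) :
  riemann (e a) (e b) (e c) (e d) = 4^-1 * (riemann_int n C a b c d)%:~R.
Proof.
have connl v w : scalar (fun u => dotv (conn u v) w).
  by move=> t u u'; rewrite !(connE, dotvE).
have connr v w : scalar (fun u => dotv (conn v u) w).
  by move=> t u u'; rewrite !(connE, dotvE).
rewrite /riemann /curvature !dotvE opprB.
rewrite -(scalarE (br _ _) (connl _ _)).
rewrite -(scalarE (conn (e b) (e c)) (connr _ _)).
rewrite -(scalarE (conn (e a) (e c)) (connr _ _)).
rewrite -sumrB -big_split mulrC; apply: (canRL (mulfK _)).
  by rewrite pnatr_eq0.
rewrite mulr_suml; apply: isumE => k /=.
rewrite CE -!(dotv_evec (conn _ _)) !conn_evec /conn_int.
rewrite !(intrD, intrM, rmorphN) /=.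
by field.
Qed.

Lemma ricci_evec (a b : 'I_n) :
  ricci (e a) (e b) = 4^-1 * (ricci_int n C a b)%:~R.
Proof.
rewrite -(isumE (G := fun k : 'I_n => (riemann_int n C a k b k)%:~R))// mulr_sumr.
by apply: eq_bigr => k _; exact: riemann_evec.
Qed.

Context (rhoP : diagonal_ricci n C rho).

Lemma ricci_evec_diag (a b : 'I_n) :
  ricci (e a) (e b) = if a == b then 2^-1 * (rho a)%:~R else 0.
Proof.
have/allP/(_ a) := rhoP; rewrite mem_iota ltn_ord => /(_ isT)/allP/(_ b).
rewrite mem_iota ltn_ord => /(_ isT)/eqP E; rewrite ricci_evec E.
rewrite -[nat_of_ord a == b]/(a == b); case: eqP => _; last by rewrite mulr0.
by rewrite intrM; field.
Qed.

Lemma ricci_evec_rowl (a : 'I_n) v : ricci v (e a) = 2^-1 * (rho a)%:~R * v 0 a.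
Proof.
rewrite -(scalarE v (ricci_bilinear.1 (e a))) (bigD1 a)//= ricci_evec_diag eqxx.
rewrite big1 ?addr0 1?mulrC// => b ba.
by rewrite ricci_evec_diag (negbTE ba) mulr0.
Qed.

Lemma ricci_evec_rowr (a : 'I_n) v : ricci (e a) v = 2^-1 * (rho a)%:~R * v 0 a.
Proof.
rewrite -(scalarE v (ricci_bilinear.2 (e a))) (bigD1 a)//= ricci_evec_diag eqxx.
rewrite big1 ?addr0 1?mulrC// => b ba.
by rewrite ricci_evec_diag eq_sym (negbTE ba) mulr0.
Qed.

(** For a diagonal Ricci tensor only two connection coefficients occur, and they
are opposite since [conn u] is skew. *)
Lemma nabla_ricci_evec (c a b : 'I_n) :
  nabla_ricci (e c) (e a) (e b) = 4^-1 * (nabla_ricci_int C rho c a b)%:~R.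
Proof.
rewrite /nabla_ricci ricci_evec_rowl ricci_evec_rowr -!(dotv_evec (conn _ _)).
rewrite (conn_skew _ (e b)) conn_evec /nabla_ricci_int /conn_int.
rewrite !(intrM, intrD, rmorphN) /=.
by field.
Qed.

Context (x : 'rV[R]_(m + r)) (E : 'M[R]_(m + r)) (Eo : Defs.orthonormal g x E).

Lemma ric_ric_R_value : ric_ric_R g x E = 16^-1 * (ric_ric_R_int n C rho)%:~R.
Proof.
rewrite (ric_ric_R_frame Eo) mulrC; apply: (canRL (mulfK _)).
  by rewrite pnatr_eq0.
rewrite mulr_suml; apply: isumE => a; rewrite mulr_suml; apply: isumE => b.
rewrite (bigD1 a)//= [X in _ + X]big1 => [|c ca]; last first.
  by rewrite big1 // => d _; rewrite ricci_evec_diag eq_sym (negbTE ca) !mul0r.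
rewrite addr0 (bigD1 b)//= [X in _ + X]big1 => [|d db]; last first.
  by rewrite (ricci_evec_diag b) eq_sym (negbTE db) mulr0 mul0r.
rewrite addr0 !ricci_evec_diag !eqxx riemann_evec !intrM.
by field.
Qed.

Lemma ric_R_R_value : ric_R_R g x E = 32^-1 * (ric_R_R_int n C rho)%:~R.
Proof.
rewrite (ric_R_R_frame Eo) mulrC; apply: (canRL (mulfK _)).
  by rewrite pnatr_eq0.
rewrite mulr_suml; apply: isumE => a.
rewrite (bigD1 a)//= [X in _ + X]big1 => [|b ba]; last first.
  rewrite big1 // => c _; rewrite big1 // => d _; rewrite big1 // => k _.
  by rewrite ricci_evec_diag eq_sym (negbTE ba) !mul0r.
rewrite addr0 mulr_suml; apply: isumE => c; rewrite mulr_suml; apply: isumE => d.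
rewrite mulr_suml; apply: isumE => k.
by rewrite ricci_evec_diag eqxx !riemann_evec !intrM; field.
Qed.

Lemma nabla_ric_nabla_ric_value :
  nabla_ric_nabla_ric g x E = 16^-1 * (nabla_ric_nabla_ric_int n C rho)%:~R.
Proof.
rewrite (nabla_ric_nabla_ric_frame Eo) mulrC; apply: (canRL (mulfK _)).
  by rewrite pnatr_eq0.
rewrite mulr_suml; apply: isumE => a; rewrite mulr_suml; apply: isumE => b.
rewrite mulr_suml; apply: isumE => c.
by rewrite !nabla_ricci_evec !intrM; field.
Qed.

Lemma norm2_nabla_ric_value :
  norm2_nabla_ric g x E = 16^-1 * (norm2_nabla_ric_int n C rho)%:~R.
Proof.
rewrite (norm2_nabla_ric_frame Eo) mulrC; apply: (canRL (mulfK _)).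
  by rewrite pnatr_eq0.
rewrite mulr_suml; apply: isumE => a; rewrite mulr_suml; apply: isumE => b.
rewrite mulr_suml; apply: isumE => c.
by rewrite !nabla_ricci_evec !intrM; field.
Qed.

End StructureConstants.
End TwoStep.

(** * The two Lie algebras *)

(** The component on the [k]-th central basis vector of the bracket of two basis
vectors [a], [b] is the entry in row [b] and column [a] of the matrix [J k]. *)
Definition bracket_coef m (J : nat -> nat -> nat -> int) (a b k : nat) : int :=
  if [&& a < m, b < m & m <= k]%N then J (k - m)%N b a else 0.

Lemma br_evec (R : realType) m r (j : so_map R m r)
    (J : nat -> nat -> nat -> int) :
  (forall (k : 'I_r) (b a : 'I_m), j (evec k) b a = (J k b a)%:~R) ->
  forall a b k : 'I_(m + r),
    br j (evec a) (evec b) 0 k = (bracket_coef m J a b k)%:~R.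
Proof.
move=> JE a b k.
have el (i : 'I_m) : lsubmx (evec (lshift r i) : 'rV[R]_(m + r)) = evec i.
  by apply/rowP => l; rewrite !mxE (inj_eq (@lshift_inj _ _)).
have er (i : 'I_r) : lsubmx (evec (rshift m i) : 'rV[R]_(m + r)) = 0.
  by apply/rowP => l; rewrite !mxE eq_lrshift.
rewrite /br; case: (split_ordP k) => {}k ->.
  by rewrite row_mxEl mxE /bracket_coef /= [(m <= k)%N]leqNgt ltn_ord !andbF.
rewrite row_mxEr mxE /bracket_coef /= leq_addr addKn andbT.
case: (split_ordP a) => {}a ->; last first.
  by rewrite er /dotv !mul0mx mxE.
case: (split_ordP b) => {}b ->; last first.
  by rewrite er andbF /dotv trmx0 mulmx0 mxE.
by rewrite !el dotv_evec -rowE !mxE JE.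
Qed.

Definition unit_entries (rows : int -> int -> int -> seq (seq int)) (k b a : nat) :=
  nth 0 (nth [::] (rows (k == 0%N)%:R (k == 1%N)%:R (k == 2%N)%:R) b) a.

Definition j_coef := unit_entries (fun c1 c2 c3 =>
  [:: [::   0;   0;   0; -c3;  c2];
      [::   0;   0;  c3;   0; -c1];
      [::   0; -c3;   0;   0;   0];
      [::  c3;   0;   0;   0;   0];
      [:: -c2;  c1;   0;   0;   0]]).

Definition j'_coef := unit_entries (fun c1 c2 c3 =>
  [:: [::   0; -c3;   0;   0;   0];
      [::  c3;   0;   0;   0;   0];
      [::   0;   0;   0; -c3;  c2];
      [::   0;   0;  c3;   0; -c1];
      [::   0;   0; -c2;  c1;   0]]).

Lemma j_coefE (R : realType) (k : 'I_3) (b a : 'I_5) :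
  jmap R (evec k) b a = (j_coef k b a)%:~R.
Proof.
by case: k => [[|[|[|//]]] ?]; move: b a; mx5_cases; rewrite !mxE /= ?mxE ?mulrNz.
Qed.

Lemma j'_coefE (R : realType) (k : 'I_3) (b a : 'I_5) :
  jmap' R (evec k) b a = (j'_coef k b a)%:~R.
Proof.
by case: k => [[|[|[|//]]] ?]; move: b a; mx5_cases; rewrite !mxE /= ?mxE ?mulrNz.
Qed.

(** Twice the eigenvalues of the Ricci tensor. *)
Definition j_rho (a : nat) : int := [:: -2; -2; -1; -1; -2; 1; 1; 2]`_a.

Definition j'_rho (a : nat) : int := [:: -1; -1; -2; -2; -2; 1; 1; 2]`_a.

Lemma j_invariants (R : realType) x E :
  Defs.orthonormal (nil_metric (jmap R)) x E ->
  [/\ ric_ric_R (nil_metric (jmap R)) x E = - 7,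
      ric_R_R (nil_metric (jmap R)) x E = - (21 / 2),
      nabla_ric_nabla_ric (nil_metric (jmap R)) x E = - 5 &
      norm2_nabla_ric (nil_metric (jmap R)) x E = 11].
Proof.
move=> Eo; have CE := br_evec (@j_coefE R).
have rhoP : diagonal_ricci 8 (bracket_coef 5 j_coef) j_rho by vm_compute.
split.
- rewrite (ric_ric_R_value CE rhoP Eo).
  have -> : ric_ric_R_int 8 (bracket_coef 5 j_coef) j_rho = - 112 by vm_compute.
  by field.
- rewrite (ric_R_R_value CE rhoP Eo).
  have -> : ric_R_R_int 8 (bracket_coef 5 j_coef) j_rho = - 336 by vm_compute.
  by field.
- rewrite (nabla_ric_nabla_ric_value CE rhoP Eo).
  have -> : nabla_ric_nabla_ric_int 8 (bracket_coef 5 j_coef) j_rho = - 80.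
    by vm_compute.
  by field.
- rewrite (norm2_nabla_ric_value CE rhoP Eo).
  have -> : norm2_nabla_ric_int 8 (bracket_coef 5 j_coef) j_rho = 176.
    by vm_compute.
  by field.
Qed.

Lemma j'_invariants (R : realType) x E :
  Defs.orthonormal (nil_metric (jmap' R)) x E ->
  [/\ ric_ric_R (nil_metric (jmap' R)) x E = - (59 / 8),
      ric_R_R (nil_metric (jmap' R)) x E = - (43 / 4),
      nabla_ric_nabla_ric (nil_metric (jmap' R)) x E = - (43 / 8) &
      norm2_nabla_ric (nil_metric (jmap' R)) x E = 43 / 4].
Proof.
move=> Eo; have CE := br_evec (@j'_coefE R).
have rhoP : diagonal_ricci 8 (bracket_coef 5 j'_coef) j'_rho by vm_compute.
split.
- rewrite (ric_ric_R_value CE rhoP Eo).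
  have -> : ric_ric_R_int 8 (bracket_coef 5 j'_coef) j'_rho = - 118 by vm_compute.
  by field.
- rewrite (ric_R_R_value CE rhoP Eo).
  have -> : ric_R_R_int 8 (bracket_coef 5 j'_coef) j'_rho = - 344 by vm_compute.
  by field.
- rewrite (nabla_ric_nabla_ric_value CE rhoP Eo).
  have -> : nabla_ric_nabla_ric_int 8 (bracket_coef 5 j'_coef) j'_rho = - 86.
    by vm_compute.
  by field.
- rewrite (norm2_nabla_ric_value CE rhoP Eo).
  have -> : norm2_nabla_ric_int 8 (bracket_coef 5 j'_coef) j'_rho = 172.
    by vm_compute.
  by field.
Qed.

Theorem proposition8 (R : realType) :
  let M := nilmanifold (jmap R) (@j_int R) in
  let M' := nilmanifold (jmap' R) (@j'_int R) in
  [/\ differ_in M M' ric_ric_R,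
      differ_in M M' ric_R_R,
      differ_in M M' nabla_ric_nabla_ric &
      differ_in M M' norm2_nabla_ric].
Proof.
move=> M M'; split.
- exists (- 7), (- (59 / 8)); split=> [p a x E _ _ /j_invariants[]//||].
    by move=> p a x E _ _ /j'_invariants[].
  by lra.
- exists (- (21 / 2)), (- (43 / 4)); split=> [p a x E _ _ /j_invariants[]//||].
    by move=> p a x E _ _ /j'_invariants[].
  by lra.
- exists (- 5), (- (43 / 8)); split=> [p a x E _ _ /j_invariants[]//||].
    by move=> p a x E _ _ /j'_invariants[].
  by lra.
- exists 11, (43 / 4); split=> [p a x E _ _ /j_invariants[]//||].
    by move=> p a x E _ _ /j'_invariants[].
  by lra.
Qed.
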